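(* For all nonnegative integers $k,l$, \[ \sum_{n=0}^\infty \frac{Q_l(H_n,H_n^{(2)},\dots,H_n^{(l)})\,P_k(H_n,H_n^{(2)},\dots,H_n^{(k)})}{(n+1)(n+2)} =\begin{cases} \displaystyle\sum_{j=0}^k\binom{k+l-j}{k+1-j}\zeta(k+l-j)-\zeta(l), & l\ge 2,\\[2ex] \displaystyle\sum_{j=0}^{k-1}\zeta(k+1-j)+1, & l=1,\\[2ex] 1, & l=0. \end{cases} \]
   Context: For integers $r\ge1$ and $n\ge0$, $H_n^{(r)}=\sum_{j=1}^n j^{-r}$ (so $H_0^{(r)}=0$), and $H_n=H_n^{(1)}$. The polynomials $P_n,Q_n\in\mathbb{Q}[y_1,\dots,y_n]$ are defined by $P_0=Q_0=1$ and, for $n\ge1$, $P_n(y_1,\dots,y_n)=\sum_{m_1+2m_2+3m_3+\cdots=n}\frac{(-1)^{m_2+m_4+\cdots}}{m_1!m_2!\cdots}\prod_{i\ge1}\left(\frac{y_i}{i}\right)^{m_i}$ and $Q_n(y_1,\dots,y_n)=\sum_{m_1+2m_2+\cdots=n}\frac{1}{m_1!m_2!\cdots}\prod_{i\ge1}\left(\frac{y_i}{i}\right)^{m_i}$, the sums over tuples of nonnegative integers $(m_1,m_2,\dots)$. (Equivalently, $P_n(p_1,\dots,p_n)=e_n$ and $Q_n(p_1,\dots,p_n)=h_n$, where $p_i,e_i,h_i$ are the power-sum, elementary and complete symmetric functions.) $\zeta$ is the Riemann zeta function. *)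

(* Defs.v *)
From Stdlib Require Import Reals Lra Lia List Arith.
From Stdlib Require Import Classical ClassicalEpsilon.
Import ListNotations.
Open Scope R_scope.

Fixpoint rsum (n : nat) (f : nat -> R) : R :=
  match n with
  | O => 0
  | S n' => rsum n' f + f n'
  end.

Fixpoint Hr (r n : nat) : R :=
  match n with
  | O => 0
  | S n' => Hr r n' + / (INR (S n') ^ r)
  end.

Definition H (n : nat) : R := Hr 1 n.

(* Riemann zeta at an integer s: the limit of H_n^{(s)} (only used for s >= 2,
   where the series converges). *)
Definition zeta (s : nat) : R :=
  epsilon (inhabits 0) (fun z => Un_cv (fun n => Hr s n) z).

Fixpoint tuples (len b : nat) : list (list nat) :=
  match len with
  | O => [nil]
  | S l => flat_map (fun a => map (cons a) (tuples l b)) (seq 0 (S b))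
  end.

(* For m = [m_i; m_{i+1}; ...]: sum of j * m_j *)
Fixpoint wsum (i : nat) (m : list nat) : nat :=
  match m with
  | nil => O
  | a :: t => (i * a + wsum (S i) t)%nat
  end.

Fixpoint evsum (i : nat) (m : list nat) : nat :=
  match m with
  | nil => O
  | a :: t => ((if Nat.even i then a else O) + evsum (S i) t)%nat
  end.

Fixpoint mono (y : nat -> R) (i : nat) (m : list nat) : R :=
  match m with
  | nil => 1
  | a :: t => ((y i / INR i) ^ a / INR (fact a)) * mono y (S i) t
  end.

(* P_n(y_1,...,y_n): sum over (m_1,...,m_n) with m_1 + 2 m_2 + ... + n m_n = n
   (necessarily each m_i <= n, and m_i = 0 for i > n). *)
Definition Pn (n : nat) (y : nat -> R) : R :=
  fold_right Rplus 0
    (map (fun m => if Nat.eqb (wsum 1 m) n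
                   then (-1) ^ (evsum 1 m) * mono y 1 m else 0)
         (tuples n n)).

Definition Qn (n : nat) (y : nat -> R) : R :=
  fold_right Rplus 0
    (map (fun m => if Nat.eqb (wsum 1 m) n then mono y 1 m else 0)
         (tuples n n)).

Definition Hvec (n : nat) : nat -> R := fun i => Hr i n.

Definition summand (k l n : nat) : R :=
  Qn l (Hvec n) * Pn k (Hvec n) / (INR (n + 1) * INR (n + 2)).

Definition rhs (k l : nat) : R :=
  match l with
  | O => 1
  | 1%nat => rsum k (fun j => zeta (k + 1 - j)) + 1
  | _ => rsum (S k) (fun j => C (k + l - j) (k + 1 - j) * zeta (k + l - j)) - zeta l
  end.

(* Main.v *)
(* Generating functions: with a_n = prod_(j<=n) (j+y)/(j-x), the numerators
   Q_l P_k are the coefficients of x^l y^k in a_n (Newton's identities).  Two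
   Abel summations give
     (1-y) sum_n a_n/((n+1)(n+2)) = 1 + x + x(x+y) K,
     K = sum_n (1+y)_n / ((n+1) (1-x)_(n+1)),
   and K = sum_m 1/((m+1-x)(m+1-x-y)): replacing x by x-m and telescoping in m
   writes K as the double sum of (1+y)_n / (m+1-x)_(n+2), whose sum over n
   telescopes as well.  Everything is done coefficientwise, where all terms are
   nonnegative, so that the exchange of sums is Tonelli's. *)
Require Import Defs.
From Stdlib Require Import Reals.
From Stdlib Require Import Lra Lia List Arith ClassicalEpsilon.
From Coquelicot Require Import Rbar Lim_seq.
Open Scope R_scope.

(** * Finite sums *)

Lemma rsum_ext n f g :
  (forall i, (i < n)%nat -> f i = g i) -> rsum n f = rsum n g.
Proof.
  induction n as [|n IH]; intros Hfg; simpl; [reflexivity|].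
  rewrite IH, (Hfg n) by (intros; try apply Hfg; lia); reflexivity.
Qed.

Lemma rsum_plus n f g : rsum n (fun i => f i + g i) = rsum n f + rsum n g.
Proof. induction n as [|n IH]; simpl; [ring|rewrite IH; ring]. Qed.

Lemma rsum_scal n c f : rsum n (fun i => c * f i) = c * rsum n f.
Proof. induction n as [|n IH]; simpl; [ring|rewrite IH; ring]. Qed.

Lemma rsum_zero n f : (forall i, (i < n)%nat -> f i = 0) -> rsum n f = 0.
Proof.
  induction n as [|n IH]; intros Hf; simpl; [reflexivity|].
  rewrite IH, (Hf n) by (intros; try apply Hf; lia); ring.
Qed.

Lemma rsum_first n f : rsum (S n) f = f O + rsum n (fun i => f (S i)).
Proof. induction n as [|n IH]; simpl in *; [ring|rewrite IH; ring]. Qed.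

Lemma rsum_exchange n m (f : nat -> nat -> R) :
  rsum n (fun i => rsum m (fun j => f i j)) =
  rsum m (fun j => rsum n (fun i => f i j)).
Proof.
  induction n as [|n IH]; simpl.
  - symmetry; apply rsum_zero; reflexivity.
  - rewrite IH, <- rsum_plus; reflexivity.
Qed.

Lemma rsum_truncate l n f :
  (l <= n)%nat -> (forall i, (l <= i)%nat -> f i = 0) -> rsum n f = rsum l f.
Proof.
  intros Hln Hf; induction Hln as [|n Hln IH]; simpl; [reflexivity|].
  rewrite IH, (Hf n Hln); ring.
Qed.

Lemma rsum_le n f g : (forall i, f i <= g i) -> rsum n f <= rsum n g.
Proof.
  intros Hfg; induction n as [|n IH]; simpl; [lra|]. specialize (Hfg n); lra.
Qed.

Lemma rsum_telescope n f : rsum n (fun i => f i - f (S i)) = f O - f n.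
Proof. induction n as [|n IH]; simpl; [ring|rewrite IH; ring]. Qed.

Lemma rsum_lim n (f : nat -> nat -> R) (s : nat -> R) :
  (forall i, is_lim_seq (f i) (s i)) ->
  is_lim_seq (fun M => rsum n (fun i => f i M)) (rsum n s).
Proof.
  intros Hf; induction n as [|n IH]; simpl.
  - apply is_lim_seq_const.
  - apply (is_lim_seq_plus' _ _ _ _ IH (Hf n)).
Qed.

Lemma rsum_lsum n f :
  fold_right Rplus 0 (map f (seq 0 n)) = rsum n f.
Proof.
  assert (G : forall s, fold_right Rplus 0 (map f (seq s n))
                        = rsum n (fun i => f (s + i)%nat)).
  { induction n as [|n IH]; intros s; [reflexivity|].
    rewrite rsum_first; cbn [seq map fold_right]; rewrite IH, Nat.add_0_r.
    f_equal; apply rsum_ext; intros; f_equal; lia. }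
  apply G.
Qed.

Lemma fold_sum_app (l l' : list R) :
  fold_right Rplus 0 (l ++ l') = fold_right Rplus 0 l + fold_right Rplus 0 l'.
Proof. induction l as [|a l IH]; simpl; [ring|rewrite IH; ring]. Qed.

Lemma fold_sum_flat_map {X Y} (f : Y -> R) (g : X -> list Y) l :
  fold_right Rplus 0 (map f (flat_map g l)) =
  fold_right Rplus 0 (map (fun a => fold_right Rplus 0 (map f (g a))) l).
Proof.
  induction l as [|a l IH]; simpl; [reflexivity|].
  rewrite map_app, fold_sum_app, IH; reflexivity.
Qed.

Lemma fold_sum_scal {X} c (f : X -> R) l :
  fold_right Rplus 0 (map (fun a => c * f a) l) =
  c * fold_right Rplus 0 (map f l).
Proof. induction l as [|a l IH]; simpl; [ring|rewrite IH; ring]. Qed.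

(** * The polynomials [Pn] and [Qn] via Newton's identities *)

(* Fixing the total weight [N] and letting the offset [s] vary makes the
   recursion below stay inside one set of tuples. *)
Definition weighted_sum (y : nat -> R) (i len b N s : nat) : R :=
  fold_right Rplus 0
    (map (fun m => if Nat.eqb (wsum i m + s) N then mono y i m else 0)
         (tuples len b)).

(** Conditions on the first multiplicity [a], whose weight [i * a] moves into the offset. *)
Lemma weighted_sum_S y i len b N s :
  weighted_sum y i (S len) b N s =
  rsum (S b) (fun a => (y i / INR i) ^ a / INR (fact a)
                       * weighted_sum y (S i) len b N (i * a + s)).
Proof.
  unfold weighted_sum; cbn [tuples].
  rewrite fold_sum_flat_map, rsum_lsum.
  apply rsum_ext; intros a _.
  rewrite map_map, <- fold_sum_scal; f_equal.
  apply map_ext; intros m; cbn [wsum mono].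
  replace (i * a + wsum (S i) m + s)%nat with (wsum (S i) m + (i * a + s))%nat by lia.
  destruct (Nat.eqb _ N); ring.
Qed.

Lemma weighted_sum_large y i len b N s :
  (N < s)%nat -> weighted_sum y i len b N s = 0.
Proof.
  intros Hs; unfold weighted_sum.
  induction (tuples len b) as [|m l IH]; [reflexivity|].
  cbn [map fold_right]; rewrite IH.
  destruct (Nat.eqb_spec (wsum i m + s) N); [lia|ring].
Qed.

(** The offset already uses up all the weight, so only the zero tuple survives: a positive
    multiplicity overshoots [N]. *)
Lemma weighted_sum_full y i len b N :
  (1 <= i)%nat -> weighted_sum y i len b N N = 1.
Proof.
  revert i; induction len as [|len IH]; intros i Hi.
  - unfold weighted_sum; simpl; rewrite Nat.eqb_refl; ring.
  - rewrite weighted_sum_S, rsum_first, rsum_zero.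
    + rewrite Nat.mul_0_r, Nat.add_0_l, IH by lia; simpl; field.
    + intros a _; rewrite weighted_sum_large; [ring|nia].
Qed.

(* The product of the exponentials [exp (y_j t^j / j)] has logarithmic
   derivative [sum_j y_j t^(j-1)]; this is that fact read off at [t^(N-s)]. *)
Lemma weighted_sum_newton y len b N :
  (N <= b)%nat -> forall i s, (1 <= i)%nat ->
  (INR N - INR s) * weighted_sum y i len b N s =
  rsum len (fun t => y (i + t)%nat * weighted_sum y i len b N (i + t + s)).
Proof.
  intros HN; induction len as [|len IH]; intros i s Hi.
  - unfold weighted_sum; simpl.
    destruct (Nat.eqb_spec s N) as [->|]; ring.
  - set (E a := (y i / INR i) ^ a / INR (fact a)).
    set (W s := weighted_sum y (S i) len b N s).
    assert (HS : forall s, weighted_sum y i (S len) b N s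
                           = rsum (S b) (fun a => E a * W (i * a + s)%nat)).
    { intros; apply weighted_sum_S. }
    (* Since i a E(a) = y_i E(a-1), this is an index shift; the extra top term [a = b] vanishes
       because [N <= b] pushes its offset past [N]. *)
    assert (Hfirst : rsum (S b) (fun a => INR (i * a) * (E a * W (i * a + s)%nat))
                     = y i * weighted_sum y i (S len) b N (i + s)).
    { rewrite HS, rsum_first, <- rsum_scal.
      cbn [rsum]; replace (W (i * b + (i + s))%nat) with 0
        by (symmetry; apply weighted_sum_large; nia).
      rewrite Nat.mul_0_r; simpl INR.
      rewrite Rmult_0_l, Rplus_0_l, !Rmult_0_r, Rplus_0_r.
      apply rsum_ext; intros a _.
      replace (i * S a + s)%nat with (i * a + (i + s))%nat by lia.
      replace (INR (i * S a) * (E (S a) * W (i * a + (i + s))%nat))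
        with ((INR (i * S a) * E (S a)) * W (i * a + (i + s))%nat) by ring.
      rewrite <- Rmult_assoc; f_equal; unfold E.
      rewrite mult_INR, fact_simpl, mult_INR; cbn [pow].
      field; repeat split; try apply INR_fact_neq_0; apply not_0_INR; lia. }
    (* The remaining weight N - (i a + s) is carried by parts larger than i, where the induction
       hypothesis applies. *)
    assert (Hrest : rsum (S b) (fun a => (INR N - INR (i * a + s)) * (E a * W (i * a + s)%nat))
       = rsum len (fun t => y (i + S t)%nat * weighted_sum y i (S len) b N (i + S t + s))).
    { rewrite (rsum_ext _ _ (fun a => rsum len (fun t =>
         y (i + S t)%nat * (E a * W (i * a + (i + S t + s))%nat)))).
      - rewrite rsum_exchange; apply rsum_ext; intros t _.
        rewrite rsum_scal, HS; reflexivity.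
      - intros a _.
        transitivity (E a * ((INR N - INR (i * a + s)) * W (i * a + s)%nat)); [ring|].
        unfold W at 1; rewrite IH by lia; rewrite <- rsum_scal.
        apply rsum_ext; intros t _; unfold W.
        replace (S i + t)%nat with (i + S t)%nat by lia.
        replace (i + S t + (i * a + s))%nat with (i * a + (i + S t + s))%nat by lia.
        ring. }
    rewrite (rsum_first len), Nat.add_0_r, <- Hfirst, <- Hrest, <- rsum_plus, HS, <- rsum_scal.
    apply rsum_ext; intros a _; rewrite (plus_INR (i * a) s); ring.
Qed.

(** Newton's recursion determines a sequence from its initial value, by strong induction on the
    remaining weight [l = N - s]. The tuples keep length [N]; terms of the recursion beyond the
    first [l] have offset above [N] and vanish. *)
Lemma weighted_sum_unique y b N (q : nat -> R) :
  (N <= b)%nat ->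
  (forall l, INR l * q l = rsum l (fun i => y (S i) * q (l - 1 - i)%nat)) ->
  weighted_sum y 1 N b N 0 * q O = q N.
Proof.
  intros HN Hq.
  assert (G : forall l s, (l + s = N)%nat -> weighted_sum y 1 N b N s * q O = q l).
  { induction l as [l IH] using lt_wf_ind; intros s Hs.
    destruct l as [|l].
    - replace s with N by lia; rewrite weighted_sum_full by lia; ring.
    - apply (Rmult_eq_reg_l (INR (S l))); [|apply not_0_INR; lia].
      rewrite Hq, <- Rmult_assoc.
      replace (INR (S l)) with (INR N - INR s)
        by (rewrite <- Hs, plus_INR; ring).
      rewrite weighted_sum_newton by lia.
      rewrite (rsum_truncate (S l)); [|lia|].
      + rewrite Rmult_comm, <- rsum_scal; apply rsum_ext; intros i Hi.
        rewrite <- (IH (S l - 1 - i)%nat) with (s := (1 + i + s)%nat) by lia.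
        simpl; ring.
      + intros i Hi; rewrite weighted_sum_large by lia; ring. }
  apply G; lia.
Qed.

Lemma Qn_newton y N (q : nat -> R) :
  (forall l, INR l * q l = rsum l (fun i => y (S i) * q (l - 1 - i)%nat)) ->
  Qn N y * q O = q N.
Proof.
  intros Hq; rewrite <- (weighted_sum_unique y N N q) by (auto; lia).
  unfold Qn, weighted_sum; do 2 f_equal; apply map_ext; intros m.
  rewrite Nat.add_0_r; reflexivity.
Qed.

(** Each part of size j contributes the sign (-1)^(j-1), which is absorbed into y_j; this reduces
    [Pn] to [Qn]. *)
Lemma signed_mono y m i : (1 <= i)%nat ->
  (-1) ^ evsum i m * mono y i m = mono (fun j => (-1) ^ (j - 1) * y j) i m.
Proof.
  revert i; induction m as [|a m IH]; intros i Hi; simpl; [ring|].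
  rewrite <- IH by lia; rewrite pow_add.
  replace ((-1) ^ (i - 1) * y i / INR i) with ((-1) ^ (i - 1) * (y i / INR i))
    by (unfold Rdiv; ring).
  rewrite Rpow_mult_distr.
  replace (((-1) ^ (i - 1)) ^ a) with ((-1) ^ (if Nat.even i then a else 0)).
  { unfold Rdiv; ring. }
  destruct (Nat.even i) eqn:Ev.
  - apply Nat.even_spec in Ev; destruct Ev as [j Ej].
    replace (i - 1)%nat with (S (2 * (j - 1))) by lia.
    rewrite pow_1_odd; reflexivity.
  - assert (Od : Nat.odd i = true) by (rewrite <- Nat.negb_even, Ev; reflexivity).
    apply Nat.odd_spec in Od; destruct Od as [j Ej].
    replace (i - 1)%nat with (2 * j)%nat by lia.
    rewrite pow_1_even, pow1; reflexivity.
Qed.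

Lemma Pn_newton y N (q : nat -> R) :
  (forall l, INR l * q l = rsum l (fun i => (-1) ^ i * y (S i) * q (l - 1 - i)%nat)) ->
  Pn N y * q O = q N.
Proof.
  intros Hq; rewrite <- (Qn_newton (fun j => (-1) ^ (j - 1) * y j) N q).
  - unfold Qn, Pn; do 2 f_equal; apply map_ext; intros m.
    rewrite signed_mono by lia; reflexivity.
  - intros l; rewrite Hq; apply rsum_ext; intros i _.
    replace (S i - 1)%nat with i by lia; reflexivity.
Qed.

(** * Coefficients of rising factorials and of their inverses *)

(* Coefficient sequence of the product by the variable. *)
Definition shift (f : nat -> R) (l : nat) : R :=
  match l with O => 0 | S l' => f l' end.

(* [rising n k] is the coefficient of [y^k] in [(1+y)(2+y)...(n+y)]. *)
Fixpoint rising (n k : nat) : R :=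
  match n with
  | O => match k with O => 1 | S _ => 0 end
  | S n' => INR (S n') * rising n' k + shift (rising n') k
  end.

(* [inv_rising m n l] is the coefficient of [x^l] in
   [1 / ((m+1-x)(m+2-x)...(m+n-x))]. *)
Fixpoint inv_rising (m n : nat) : nat -> R :=
  match n with
  | O => fun l => match l with O => 1 | S _ => 0 end
  | S n' => fix inv l :=
      match l with
      | O => inv_rising m n' O / INR (m + S n')
      | S l' => (inv_rising m n' (S l') + inv l') / INR (m + S n')
      end
  end.

Lemma inv_rising_S m n l :
  INR (m + S n) * inv_rising m (S n) l =
  inv_rising m n l + shift (inv_rising m (S n)) l.
Proof.
  assert (INR (m + S n) <> 0) by (apply not_0_INR; lia).
  destruct l; cbn [inv_rising shift]; field; assumption.
Qed.

(** Induction on n: with c = n+1, the new factor c+y adds 1/(c+y), the series of (-1)^i y^i /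
    c^(i+1), to the logarithmic derivative. [Hgeo] says that this series times [rising (S n)] gives
    back [rising n]. *)
Lemma rising_newton n l :
  INR l * rising n l =
  rsum l (fun i => (-1) ^ i * Hr (S i) n * rising n (l - 1 - i)%nat).
Proof.
  revert l; induction n as [|n IH]; intros l.
  - rewrite rsum_zero by (intros; simpl; ring); destruct l; simpl; ring.
  - destruct l as [|l]; [simpl; ring|].
    set (c := INR (S n)); assert (Hc : c <> 0) by (apply not_0_INR; lia).
    assert (Hgeo : forall l, rsum (S l) (fun i => (-1) ^ i * / c ^ S i * rising (S n) (l - i)%nat)
                             = rising n l).
    { clear - Hc; induction l as [|l IHl].
      - cbn [rsum Nat.sub rising shift pow]; fold c; field; assumption.
      - rewrite rsum_first.
        rewrite (rsum_ext _ _ (fun i => (- / c) * ((-1) ^ i * / c ^ S i * rising (S n) (l - i)%nat))).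
        + rewrite rsum_scal, IHl; cbn [rising shift Nat.sub pow]; fold c; field; assumption.
        + intros i _; cbn [Nat.sub pow]; field.
          split; [apply pow_nonzero|]; assumption. }
    rewrite (rsum_ext _ _ (fun i =>
       (c * ((-1) ^ i * Hr (S i) n * rising n (S l - 1 - i)%nat)
        + (-1) ^ i * Hr (S i) n * shift (rising n) (l - i)%nat)
       + (-1) ^ i * / c ^ S i * rising (S n) (l - i)%nat)).
    + rewrite rsum_plus, rsum_plus, rsum_scal, <- IH, Hgeo.
      cbn [rsum]; rewrite Nat.sub_diag; cbn [shift rising]; fold c.
      rewrite (rsum_ext l _ (fun i => (-1) ^ i * Hr (S i) n * rising n (l - 1 - i)%nat)).
      * rewrite <- IH, S_INR; ring.
      * intros i Hi; replace (l - i)%nat with (S (l - 1 - i)) by lia; reflexivity.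
    + intros i _; replace (S l - 1 - i)%nat with (l - i)%nat by lia.
      cbn [Hr rising]; fold c; ring.
Qed.

(** As for [rising_newton], with 1/(c-x) added to the logarithmic derivative. The recurrence for
    [inv_rising 0 (S n)] refers to its own lower coefficients, hence the nested induction on [l]. *)
Lemma inv_rising_newton n l :
  INR l * inv_rising 0 n l =
  rsum l (fun i => Hr (S i) n * inv_rising 0 n (l - 1 - i)%nat).
Proof.
  revert l; induction n as [|n IH]; intros l.
  - rewrite rsum_zero by (intros; simpl; ring); destruct l; simpl; ring.
  - set (c := INR (S n)); assert (Hc : c <> 0) by (apply not_0_INR; lia).
    assert (HS : forall l, c * inv_rising 0 (S n) l
                 = inv_rising 0 n l + shift (inv_rising 0 (S n)) l)
      by (intros l'; exact (inv_rising_S 0 n l')).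
    assert (Hgeo : forall l, rsum (S l) (fun i => / c ^ S i * inv_rising 0 n (l - i)%nat)
                             = inv_rising 0 (S n) l).
    { clear - Hc HS; induction l as [|l IHl].
      - specialize (HS O); cbn [shift] in HS.
        cbn [rsum Nat.sub pow]; replace (inv_rising 0 n 0) with (c * inv_rising 0 (S n) 0) by lra.
        field; assumption.
      - rewrite rsum_first.
        rewrite (rsum_ext _ _ (fun i => (/ c) * (/ c ^ S i * inv_rising 0 n (l - i)%nat))).
        + rewrite rsum_scal, IHl; specialize (HS (S l)); cbn [shift] in HS.
          cbn [Nat.sub].
          replace (inv_rising 0 n (S l)) with (c * inv_rising 0 (S n) (S l) - inv_rising 0 (S n) l) by lra.
          cbn [pow]; field; assumption.
        + intros i _; cbn [Nat.sub pow]; field.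
          split; [apply pow_nonzero|]; assumption. }
    induction l as [|l IHl]; [simpl; ring|].
    apply (Rmult_eq_reg_l c); [|assumption].
    rewrite <- rsum_scal.
    rewrite (rsum_ext _ _ (fun i =>
       (Hr (S i) n * inv_rising 0 n (S l - 1 - i)%nat
        + / c ^ S i * inv_rising 0 n (l - i)%nat)
       + Hr (S i) (S n) * shift (inv_rising 0 (S n)) (l - i)%nat)).
    + rewrite rsum_plus, rsum_plus, <- IH, Hgeo.
      cbn [rsum]; rewrite Nat.sub_diag; cbn [shift].
      rewrite (rsum_ext l _ (fun i => Hr (S i) (S n) * inv_rising 0 (S n) (l - 1 - i)%nat)).
      * rewrite <- IHl.
        transitivity (INR (S l) * (c * inv_rising 0 (S n) (S l))); [ring|].
        rewrite HS; cbn [shift]; rewrite S_INR; ring.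
      * intros i Hi; replace (l - i)%nat with (S (l - 1 - i)) by lia; reflexivity.
    + intros i _; replace (S l - 1 - i)%nat with (l - i)%nat by lia.
      transitivity (Hr (S i) (S n) * (c * inv_rising 0 (S n) (l - i)%nat)); [ring|].
      rewrite HS; cbn [Hr]; fold c; ring.
Qed.

Lemma inv_rising_rising_0 n : inv_rising 0 n 0 * rising n 0 = 1.
Proof.
  induction n as [|n IH]; [simpl; ring|].
  cbn [rising inv_rising shift].
  replace (0 + S n)%nat with (S n) by lia.
  rewrite <- IH; field; apply not_0_INR; lia.
Qed.

(** Newton's identities fix each factor up to its constant term; these are n! and 1/n!, which
    cancel. *)
Lemma Qn_Pn_harmonic k l n :
  Qn l (Hvec n) * Pn k (Hvec n) = rising n k * inv_rising 0 n l.
Proof.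
  rewrite <- (Qn_newton (Hvec n) l (inv_rising 0 n) (inv_rising_newton n)).
  rewrite <- (Pn_newton (Hvec n) k (rising n) (rising_newton n)).
  transitivity (Qn l (Hvec n) * Pn k (Hvec n) * (inv_rising 0 n 0 * rising n 0)).
  - rewrite inv_rising_rising_0; ring.
  - ring.
Qed.

(** * Positivity, and dependence of the inverse factorials on m *)

Lemma rising_nonneg n k : 0 <= rising n k.
Proof.
  revert k; induction n as [|n IH]; intros k; cbn [rising].
  - destruct k; lra.
  - pose proof (pos_INR (S n)); pose proof (IH k).
    destruct k; cbn [shift]; [|specialize (IH k)]; nra.
Qed.

Lemma inv_rising_nonneg m n l : 0 <= inv_rising m n l.
Proof.
  revert l; induction n as [|n IH]; intros l; [destruct l; simpl; lra|].
  assert (Hc : 0 < INR (m + S n)) by (apply lt_0_INR; lia).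
  induction l as [|l IHl]; apply (Rmult_le_reg_l _ _ _ Hc);
    rewrite Rmult_0_r, inv_rising_S; cbn [shift]; specialize (IH O) as H0;
    [|specialize (IH (S l))]; lra.
Qed.

Lemma shift_nonneg f l : (forall i, 0 <= f i) -> 0 <= shift f l.
Proof. intros Hf; destruct l; simpl; [lra|apply Hf]. Qed.

(** Cancels the first factor m+1-x, whereas the definition peels off the last one. Multiplying both
    sides by the last factor brings in the induction hypotheses on [n] and [l]. *)
Lemma inv_rising_shift m n l :
  INR (S m) * inv_rising m (S n) l =
  inv_rising (S m) n l + shift (inv_rising m (S n)) l.
Proof.
  revert l; induction n as [|n IH]; intros l.
  - replace (S m) with (m + 1)%nat by lia; rewrite inv_rising_S; reflexivity.
  - assert (Hc : INR (m + S (S n)) <> 0) by (apply not_0_INR; lia).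
    assert (HS : forall l, INR (m + S (S n)) * inv_rising (S m) (S n) l =
                 inv_rising (S m) n l + shift (inv_rising (S m) (S n)) l).
    { intros l'; rewrite <- inv_rising_S; f_equal; f_equal; lia. }
    induction l as [|l IHl]; apply (Rmult_eq_reg_l _ _ _ ) with (2 := Hc).
    + cbn [shift]; rewrite Rplus_0_r, HS, <- Rmult_assoc, (Rmult_comm (INR _)),
        Rmult_assoc, inv_rising_S.
      cbn [shift]; rewrite !Rplus_0_r, IH; cbn [shift]; ring.
    + rewrite Rmult_plus_distr_l, HS, <- Rmult_assoc, (Rmult_comm (INR _)),
        Rmult_assoc, inv_rising_S.
      cbn [shift]; rewrite inv_rising_S, Rmult_plus_distr_l, IH, IHl.
      cbn [shift]; ring.
Qed.

(** Over the common denominator (m+1-x)_(n+1) the numerator is (m+n+1-x) - (m+1-x) = n. This drives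
    the telescoping in m. *)
Lemma inv_rising_diff m n l :
  inv_rising m n l - inv_rising (S m) n l = INR n * inv_rising m (S n) l.
Proof.
  pose proof (inv_rising_S m n l) as H1; pose proof (inv_rising_shift m n l) as H2.
  replace (m + S n)%nat with (S m + n)%nat in H1 by lia.
  rewrite plus_INR in H1; lra.
Qed.

Lemma inv_rising_le m n l : inv_rising m n l <= inv_rising 0 n l.
Proof.
  induction m as [|m IH]; [lra|].
  pose proof (inv_rising_diff m n l); pose proof (inv_rising_nonneg m (S n) l).
  pose proof (pos_INR n); nra.
Qed.

Lemma is_lim_seq_scal (u : nat -> R) (c l : R) :
  is_lim_seq u l -> is_lim_seq (fun n => c * u n) (c * l).
Proof. intros Hu; apply (is_lim_seq_scal_l u c l Hu). Qed.

Lemma is_lim_seq_inv_succ : is_lim_seq (fun n => / INR (S n)) 0.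
Proof.
  apply is_lim_seq_Reals; intros eps Heps.
  destruct (archimed_cor1 eps Heps) as [N [HN HN0]].
  exists N; intros n Hn; unfold Rdist; rewrite Rminus_0_r, Rabs_pos_eq.
  - apply Rle_lt_trans with (2 := HN), Rinv_le_contravar;
      [apply lt_0_INR; lia|apply le_INR; lia].
  - left; apply Rinv_0_lt_compat, lt_0_INR; lia.
Qed.

(** By [inv_rising_shift], m+1 times the coefficient is a sum of two coefficients, each bounded by
    its value at m = 0; so the decay is O(1/m). *)
Lemma inv_rising_lim n l : is_lim_seq (fun m => inv_rising m (S n) l) 0.
Proof.
  apply is_lim_seq_le_le with (u := fun _ => 0)
    (w := fun m => INR (S n) * inv_rising 0 (S n) l * / INR (S m)).
  - intros m; split; [apply inv_rising_nonneg|].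
    assert (Hm : 0 < INR (S m)) by (apply lt_0_INR; lia).
    apply (Rmult_le_reg_l _ _ _ Hm).
    rewrite inv_rising_shift.
    pose proof (inv_rising_S 0 n l) as H0; rewrite Nat.add_0_l in H0.
    rewrite H0, Rmult_comm, Rmult_assoc, Rinv_l, Rmult_1_r by lra.
    apply Rplus_le_compat; [apply inv_rising_le|].
    destruct l; simpl; [lra|]. apply (inv_rising_le m (S n)).
  - apply is_lim_seq_const.
  - replace (Finite 0) with (Finite (INR (S n) * inv_rising 0 (S n) l * 0))
      by (f_equal; ring).
    apply is_lim_seq_scal, is_lim_seq_inv_succ.
Qed.

(** * Limits and sums *)

(** Multiplication by x+y links (k,l) to (k-1,l) and (k,l-1); the guarding equations make the
    missing neighbours on the axes vacuous. *)
Lemma double_ind (P : nat -> nat -> Prop) :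
  (forall k l, (forall k', k = S k' -> P k' l) ->
               (forall l', l = S l' -> P k l') -> P k l) ->
  forall k l, P k l.
Proof.
  intros HP k; induction k as [|k IHk]; intros l; induction l as [|l IHl];
    apply HP; intros j Hj; inversion Hj; subst; auto.
Qed.

Lemma rsum_mean_lim (d : nat -> R) :
  is_lim_seq d 0 -> is_lim_seq (fun n => rsum (S n) d / INR (S n)) 0.
Proof.
  intros Hd; apply is_lim_seq_Reals in Hd; apply Cesaro_1 in Hd.
  apply is_lim_seq_Reals, is_lim_seq_incr_1 in Hd.
  revert Hd; apply is_lim_seq_ext; intros n; f_equal.
  simpl pred; clear; induction n as [|n IH]; simpl; [ring|rewrite IH; reflexivity].
Qed.

(** By nonnegativity every finite rectangle sums to at most [z], which bounds the row sums from
    above; a large rectangle bounds them from below. *)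
Lemma rsum_tonelli (g : nat -> nat -> R) (rows cols : nat -> R) (z : R) :
  (forall n m, 0 <= g n m) ->
  (forall n, is_lim_seq (fun M => rsum M (g n)) (rows n)) ->
  (forall m, is_lim_seq (fun N => rsum N (fun n => g n m)) (cols m)) ->
  is_lim_seq (fun M => rsum M cols) z ->
  is_lim_seq (fun N => rsum N rows) z.
Proof.
  intros Hg Hrows Hcols Hz.
  assert (Hcol : forall N m, rsum N (fun n => g n m) <= cols m).
  { intros N m; apply is_lim_seq_incr_compare
      with (u := fun N => rsum N (fun n => g n m)); [apply Hcols|].
    intros n; simpl; specialize (Hg n m); lra. }
  assert (Hrow : forall M n, rsum M (g n) <= rows n).
  { intros M n; apply is_lim_seq_incr_compare
      with (u := fun M => rsum M (g n)); [apply Hrows|].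
    intros m; simpl; specialize (Hg n m); lra. }
  assert (Hcol0 : forall m, 0 <= cols m) by (intros m; apply (Hcol O)).
  assert (Hrow0 : forall n, 0 <= rows n) by (intros n; apply (Hrow O)).
  assert (Hzle : forall M, rsum M cols <= z).
  { apply is_lim_seq_incr_compare; [exact Hz|].
    intros m; simpl; specialize (Hcol0 m); lra. }
  assert (Hle : forall N, rsum N rows <= z).
  { intros N.
    apply (is_lim_seq_le (fun M => rsum N (fun n => rsum M (g n))) (fun _ => z)
             (rsum N rows) z).
    - intros M; rewrite rsum_exchange.
      apply Rle_trans with (2 := Hzle M), rsum_le; intros m; apply Hcol.
    - apply rsum_lim, Hrows.
    - apply is_lim_seq_const. }
  apply is_lim_seq_Reals; intros eps Heps.
  apply is_lim_seq_Reals in Hz.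
  (* First enough columns to come within eps/2 of [z], then enough rows for these finitely many
     columns. *)
  destruct (Hz (eps / 2)) as [M HM]; [lra|].
  specialize (HM M (Nat.le_refl _)); unfold Rdist in HM; apply Rabs_def2 in HM.
  assert (HN : is_lim_seq (fun N => rsum M (fun m => rsum N (fun n => g n m)))
                 (rsum M cols)) by (apply rsum_lim; exact Hcols).
  apply is_lim_seq_Reals in HN.
  destruct (HN (eps / 2)) as [N0 HN0]; [lra|].
  exists N0; intros N HNge; specialize (HN0 N HNge); unfold Rdist in *.
  apply Rabs_def2 in HN0.
  rewrite rsum_exchange in HN0.
  pose proof (rsum_le N (fun j => rsum M (fun i => g j i)) rows (Hrow M)); specialize (Hle N).
  apply Rabs_def1; lra.
Qed.

Lemma Hr_rsum s n : Hr s n = rsum n (fun m => / INR (S m) ^ s).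
Proof. induction n as [|n IH]; simpl; [reflexivity|rewrite IH; reflexivity]. Qed.

(** The subtracted term makes the induction close, through 1/(a+1)^2 <= 1/a - 1/(a+1). *)
Lemma Hr_bound s n : (2 <= s)%nat -> Hr s (S n) <= 2 - / INR (S n).
Proof.
  intros Hs; induction n as [|n IH].
  - simpl; rewrite pow1; lra.
  - change (Hr s (S (S n))) with (Hr s (S n) + / INR (S (S n)) ^ s).
    set (a := INR (S n)) in *; assert (Ha : 1 <= a) by (apply (le_INR 1); lia).
    replace (INR (S (S n))) with (a + 1) by (unfold a; rewrite (S_INR (S n)); reflexivity).
    assert (/ (a + 1) ^ s <= / (a + 1) ^ 2).
    { apply Rinv_le_contravar; [apply pow_lt; lra|apply Rle_pow; [lra|assumption]]. }
    assert (/ (a + 1) ^ 2 <= / a - / (a + 1)).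
    { replace (/ a - / (a + 1)) with (/ (a * (a + 1))) by (field; lra).
      apply Rinv_le_contravar; nra. }
    lra.
Qed.

(** [epsilon] returns a genuine limit once one exists; the partial sums increase and are bounded by
    2. *)
Lemma zeta_lim s : (2 <= s)%nat -> is_lim_seq (Hr s) (zeta s).
Proof.
  intros Hs; apply is_lim_seq_Reals; unfold zeta; apply epsilon_spec.
  assert (Hpos : forall n, 0 < / INR (S n) ^ s).
  { intros n; apply Rinv_0_lt_compat, pow_lt, lt_0_INR; lia. }
  destruct (growing_cv (Hr s)) as [z Hz]; [| |exists z; exact Hz].
  - intros n; simpl; specialize (Hpos n); simpl in Hpos; lra.
  - exists 2; intros x [n ->]; destruct n as [|n]; [simpl; lra|].
    pose proof (Hr_bound s n Hs).
    assert (0 < / INR (S n)) by (apply Rinv_0_lt_compat, lt_0_INR; lia); lra.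
Qed.

(** * The double series *)

Lemma rising_succ_ge n k : INR (S n) * rising n k <= rising (S n) k.
Proof.
  cbn [rising]; pose proof (shift_nonneg (rising n) k (rising_nonneg n)); lra.
Qed.

(** (n+1+y) - (n+1-x) = x+y, applied to the common factor (1+y)_n / (1-x)_(n+1). *)
Lemma weight_diff n k l :
  rising (S n) k * inv_rising 0 (S n) l - rising n k * inv_rising 0 n l =
  rising n k * shift (inv_rising 0 (S n)) l + shift (rising n) k * inv_rising 0 (S n) l.
Proof.
  pose proof (inv_rising_S 0 n l) as H0; rewrite Nat.add_0_l in H0.
  replace (inv_rising 0 n l) with
    (INR (S n) * inv_rising 0 (S n) l - shift (inv_rising 0 (S n)) l) by lra.
  cbn [rising]; ring.
Qed.

Lemma boundary_le n k l :
  rising n k * inv_rising 0 (S n) l <=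
  rising (S n) k * inv_rising 0 (S n) l / INR (S n).
Proof.
  assert (Hn : 0 < INR (S n)) by (apply lt_0_INR; lia).
  apply (Rmult_le_reg_l _ _ _ Hn).
  replace (INR (S n) * (rising (S n) k * inv_rising 0 (S n) l / INR (S n)))
    with (rising (S n) k * inv_rising 0 (S n) l) by (field; lra).
  pose proof (rising_succ_ge n k); pose proof (inv_rising_nonneg 0 (S n) l); nra.
Qed.

Lemma is_lim_seq_squeeze0 u v :
  (forall n, 0 <= u n <= v n) -> is_lim_seq v 0 -> is_lim_seq u 0.
Proof.
  intros Huv Hv; apply is_lim_seq_le_le with (u := fun _ => 0) (w := v); auto.
  apply is_lim_seq_const.
Qed.

(* The increments of [rising n k * inv_rising 0 n l] are the terms of lower
   bidegree divided by [n], so the Cesàro mean propagates sublinear growth. *)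
Lemma weight_sublinear k l :
  is_lim_seq (fun n => rising (S n) k * inv_rising 0 (S n) l / INR (S n)) 0.
Proof.
  revert k l; apply double_ind; intros k l IHk IHl.
  set (d n := rising n k * shift (inv_rising 0 (S n)) l
              + shift (rising n) k * inv_rising 0 (S n) l).
  (* Converts the induction hypotheses at lower bidegree into decay of the two terms of [d]. *)
  assert (Hb : forall k l,
    is_lim_seq (fun n => rising (S n) k * inv_rising 0 (S n) l / INR (S n)) 0 ->
    is_lim_seq (fun n => rising n k * inv_rising 0 (S n) l) 0).
  { intros k' l'; apply is_lim_seq_squeeze0; intros n; split.
    - apply Rmult_le_pos; [apply rising_nonneg|apply inv_rising_nonneg].
    - apply boundary_le. }
  assert (Hd : is_lim_seq d 0).
  { replace (Finite 0) with (Finite (0 + 0)) by (f_equal; ring).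
    apply is_lim_seq_plus'.
    - destruct l as [|l]; cbn [shift]; [|apply Hb, IHl; reflexivity].
      apply is_lim_seq_ext with (fun _ => 0); [intros; ring|apply is_lim_seq_const].
    - destruct k as [|k]; cbn [shift]; [|apply Hb, IHk; reflexivity].
      apply is_lim_seq_ext with (fun _ => 0); [intros; ring|apply is_lim_seq_const]. }
  set (w n := rising n k * inv_rising 0 n l).
  assert (Hw : forall n, w n = w O + rsum n d).
  { induction n as [|n IH]; cbn [rsum]; [ring|].
    unfold d at 2; rewrite <- weight_diff; unfold w in *; lra. }
  apply is_lim_seq_ext with (fun n => w O * / INR (S n) + rsum (S n) d / INR (S n)).
  - intros n; fold (w (S n)); rewrite (Hw (S n)); unfold Rdiv; ring.
  - replace (Finite 0) with (Finite (w O * 0 + 0)) by (f_equal; ring).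
    apply is_lim_seq_plus'; [|apply rsum_mean_lim, Hd].
    apply is_lim_seq_scal, is_lim_seq_inv_succ.
Qed.

Lemma boundary_lim m k l : is_lim_seq (fun n => rising n k * inv_rising m (S n) l) 0.
Proof.
  apply is_lim_seq_squeeze0 with (2 := weight_sublinear k l); intros n; split.
  - apply Rmult_le_pos; [apply rising_nonneg|apply inv_rising_nonneg].
  - apply Rle_trans with (2 := boundary_le n k l).
    apply Rmult_le_compat_l; [apply rising_nonneg|apply inv_rising_le].
Qed.

(** The right-hand side of [weight_diff] is nonnegative, so the weights increase with n and the
    numerator may be replaced by its successor. *)
Lemma weight_boundary_lim k l :
  is_lim_seq (fun n => rising n k * inv_rising 0 n l / INR (S n)) 0.
Proof.
  apply is_lim_seq_squeeze0 with (2 := weight_sublinear k l); intros n.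
  assert (0 < / INR (S n)) by (apply Rinv_0_lt_compat, lt_0_INR; lia).
  pose proof (weight_diff n k l).
  assert (0 <= rising n k * inv_rising 0 n l)
    by (apply Rmult_le_pos; [apply rising_nonneg|apply inv_rising_nonneg]).
  assert (0 <= rising n k * shift (inv_rising 0 (S n)) l)
    by (apply Rmult_le_pos;
        [apply rising_nonneg|apply shift_nonneg, inv_rising_nonneg]).
  assert (0 <= shift (rising n) k * inv_rising 0 (S n) l)
    by (apply Rmult_le_pos;
        [apply shift_nonneg, rising_nonneg|apply inv_rising_nonneg]).
  unfold Rdiv; nra.
Qed.

(** m+1 = (m+n+2-x) - (n+1+y) + (x+y), times (1+y)_n / (m+1-x)_(n+2): the first two products
    telescope in n, the third lowers the bidegree. *)
Lemma row_step m n k l :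
  INR (S m) * (rising n k * inv_rising m (S (S n)) l) =
  (rising n k * inv_rising m (S n) l - rising (S n) k * inv_rising m (S (S n)) l)
  + (rising n k * shift (inv_rising m (S (S n))) l
     + shift (rising n) k * inv_rising m (S (S n)) l).
Proof.
  pose proof (inv_rising_S m (S n) l) as H1.
  replace (m + S (S n))%nat with (S m + S n)%nat in H1 by lia.
  rewrite plus_INR in H1.
  replace (inv_rising m (S n) l) with
    ((INR (S m) + INR (S n)) * inv_rising m (S (S n)) l
     - shift (inv_rising m (S (S n))) l) by lra.
  cbn [rising]; ring.
Qed.

Lemma C_1 n : C (S n) 1 = INR (S n).
Proof.
  unfold C; replace (S n - 1)%nat with n by lia.
  rewrite (fact_simpl n), mult_INR; simpl (INR (fact 1)).
  field; apply INR_fact_neq_0.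
Qed.

Lemma C_diag n : C n n = 1.
Proof.
  unfold C; rewrite Nat.sub_diag; simpl (INR (fact 0)).
  field; apply INR_fact_neq_0.
Qed.

Lemma inv_rising_1 m l : inv_rising m 1 l = / INR (S m) ^ S l.
Proof.
  assert (Hm : INR (S m) <> 0) by (apply not_0_INR; lia).
  induction l as [|l IH]; apply (Rmult_eq_reg_l _ _ _) with (2 := Hm);
    rewrite inv_rising_shift; cbn [shift].
  - simpl inv_rising; cbn [pow]; field; assumption.
  - rewrite IH; simpl inv_rising; cbn [pow]; field.
    split; [apply pow_nonzero|]; assumption.
Qed.

(** Summing [row_step] gives (m+1-x-y) G = 1/(m+1-x) for the generating function G of the limits;
    induction on the bidegree solves this and yields convergence. *)
Lemma row_lim m k l :
  is_lim_seq (fun N => rsum N (fun n => rising n k * inv_rising m (S (S n)) l))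
    (C (k + l + 1) (k + 1) * / INR (S m) ^ (k + l + 2)).
Proof.
  revert k l; apply double_ind; intros k l IHk IHl.
  assert (Hm : INR (S m) <> 0) by (apply not_0_INR; lia).
  set (t k l := C (k + l + 1) (k + 1) * / INR (S m) ^ (k + l + 2)).
  set (tl := match l with O => 0 | S l' => t k l' end).
  set (tk := match k with O => 0 | S k' => t k' l end).
  set (t0 := rising 0 k * inv_rising m 1 l).
  change (is_lim_seq (fun N => rsum N (fun n => rising n k * inv_rising m (S (S n)) l)) (t k l)).
  replace (t k l) with (/ INR (S m) * ((t0 - 0) + (tl + tk))).
  - apply is_lim_seq_ext with (fun N => / INR (S m) *
      ((t0 - rising N k * inv_rising m (S N) l)
       + (rsum N (fun n => rising n k * shift (inv_rising m (S (S n))) l)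
          + rsum N (fun n => shift (rising n) k * inv_rising m (S (S n)) l)))).
    + intros N; unfold t0; apply (Rmult_eq_reg_l (INR (S m))); [|assumption].
      rewrite <- Rmult_assoc, Rinv_r, Rmult_1_l by assumption.
      rewrite <- rsum_scal, <- rsum_plus.
      rewrite <- (rsum_telescope N (fun n => rising n k * inv_rising m (S n) l)), <- rsum_plus.
      apply rsum_ext; intros n _; symmetry; apply row_step.
    + apply is_lim_seq_scal.
      apply is_lim_seq_plus'; [|apply is_lim_seq_plus'].
      * apply is_lim_seq_minus'; [apply is_lim_seq_const|apply boundary_lim].
      * destruct l as [|l]; cbn [shift]; [|apply IHl; reflexivity].
        apply is_lim_seq_ext with (fun _ => 0); [|apply is_lim_seq_const].
        intros; symmetry; apply rsum_zero; intros; ring.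
      * destruct k as [|k]; cbn [shift]; [|apply IHk; reflexivity].
        apply is_lim_seq_ext with (fun _ => 0); [|apply is_lim_seq_const].
        intros; symmetry; apply rsum_zero; intros; ring.
  - unfold t0, tl, tk; rewrite inv_rising_1.
    assert (Hp : forall i, INR (S m) ^ i <> 0) by (intros; apply pow_nonzero; assumption).
    (* On the axes a neighbour is missing and the binomials are evaluated directly; inside, the
       recursion is Pascal's rule. *)
    destruct k as [|k], l as [|l]; cbn [rising]; unfold t.
    + rewrite C_diag; cbn [pow Nat.add]; field; assumption.
    + replace (0 + S l + 1)%nat with (S (S l)) by lia.
      replace (0 + l + 1)%nat with (S l) by lia.
      rewrite !C_1, (S_INR (S l)).
      replace (0 + S l + 2)%nat with (S (S (S l))) by lia.
      replace (0 + l + 2)%nat with (S (S l)) by lia.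
      cbn [pow]; field; auto.
    + rewrite !Nat.add_0_r, !C_diag.
      replace (S k + 2)%nat with (S (k + 2)) by lia; cbn [pow]; field; auto.
    + replace (S k + S l + 2)%nat with (S (S k + l + 2)) by lia.
      replace (S k + S l + 1)%nat with (S (S k + l + 1)) by lia.
      replace (k + S l + 2)%nat with (S k + l + 2)%nat by lia.
      replace (k + S l + 1)%nat with (S k + l + 1)%nat by lia.
      replace (S k + 1)%nat with (S (k + 1)) by lia.
      rewrite <- (pascal (S k + l + 1) (k + 1)) by lia.
      cbn [pow]; field; auto.
Qed.

(* With [F n m] the coefficient of [(1+y)_n / ((n+1) (m+1-x)_(n+1))], the
   difference [F n m - F n (m+1)] is the coefficient of
   [(1+y)_n / (m+1-x)_(n+2)], whose sum over [n] also telescopes, to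
   [1 / ((m+1-x)(m+1-x-y))]. *)
Lemma core_lim k l :
  is_lim_seq (fun N => rsum N (fun n => rising n k * inv_rising 0 (S n) l / INR (S n)))
    (C (k + l + 1) (k + 1) * zeta (k + l + 2)).
Proof.
  apply rsum_tonelli with
    (g := fun n m => rising n k * inv_rising m (S (S n)) l)
    (cols := fun m => C (k + l + 1) (k + 1) * / INR (S m) ^ (k + l + 2)).
  - intros n m; apply Rmult_le_pos; [apply rising_nonneg|apply inv_rising_nonneg].
  - intros n.
    assert (Hn : INR (S n) <> 0) by (apply not_0_INR; lia).
    set (c := rising n k / INR (S n)).
    replace (rising n k * inv_rising 0 (S n) l / INR (S n))
      with (c * inv_rising 0 (S n) l - c * 0) by (unfold c; field; assumption).
    apply is_lim_seq_ext with
      (fun M => c * inv_rising 0 (S n) l - c * inv_rising M (S n) l).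
    + intros M; rewrite <- (rsum_telescope M (fun m => c * inv_rising m (S n) l)).
      apply rsum_ext; intros m _.
      rewrite <- Rmult_minus_distr_l, inv_rising_diff; unfold c; field; assumption.
    + apply is_lim_seq_minus'; [apply is_lim_seq_const|].
      apply is_lim_seq_scal, inv_rising_lim.
  - intros m; apply row_lim.
  - apply is_lim_seq_ext with (fun M => C (k + l + 1) (k + 1) * Hr (k + l + 2) M).
    + intros M; rewrite Hr_rsum, rsum_scal; reflexivity.
    + apply is_lim_seq_scal, zeta_lim; lia.
Qed.

(** * The two Abel summations *)

(** Summation by parts with 1/((n+1)(n+2)) = 1/(n+1) - 1/(n+2); [weight_diff] supplies the
    increments. The limit is 1 + (x+y) K. *)
Lemma inner_sum N k l :
  rsum N (fun n => rising (S n) k * inv_rising 0 (S n) l / (INR (S n) * INR (S (S n)))) =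
  rsum N (fun n => rising n k * shift (inv_rising 0 (S n)) l / INR (S n))
  + rsum N (fun n => shift (rising n) k * inv_rising 0 (S n) l / INR (S n))
  + (rising 0 k * inv_rising 0 0 l - rising N k * inv_rising 0 N l / INR (S N)).
Proof.
  replace (rising 0 k * inv_rising 0 0 l)
    with (rising 0 k * inv_rising 0 0 l / INR 1) by (simpl; field).
  rewrite <- (rsum_telescope N (fun n => rising n k * inv_rising 0 n l / INR (S n))).
  rewrite <- !rsum_plus; apply rsum_ext; intros n _.
  assert (INR (S n) <> 0) by (apply not_0_INR; lia).
  assert (INR (S (S n)) <> 0) by (apply not_0_INR; lia).
  pose proof (weight_diff n k l) as Hd.
  set (w' := rising (S n) k * inv_rising 0 (S n) l) in *.
  set (w := rising n k * inv_rising 0 n l) in *.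
  rewrite <- Rdiv_plus_distr, <- Hd, (S_INR (S n)).
  rewrite (S_INR (S n)) in *; field; auto.
Qed.

(** From (n+1-x) a_(n+1) = (n+1+y) a_n follows a_n = y a_n + x a_(n+1) + (n+2) a_n - (n+1) a_(n+1);
    after division by (n+1)(n+2) the last two terms telescope. *)
Lemma outer_sum N k l :
  rsum N (fun n => rising n k * inv_rising 0 n l / (INR (S n) * INR (S (S n)))) =
  rsum N (fun n => shift (rising n) k * inv_rising 0 n l / (INR (S n) * INR (S (S n))))
  + rsum N (fun n => rising (S n) k * shift (inv_rising 0 (S n)) l
                     / (INR (S n) * INR (S (S n))))
  + (rising 0 k * inv_rising 0 0 l - rising N k * inv_rising 0 N l / INR (S N)).
Proof.
  replace (rising 0 k * inv_rising 0 0 l)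
    with (rising 0 k * inv_rising 0 0 l / INR 1) by (simpl; field).
  rewrite <- (rsum_telescope N (fun n => rising n k * inv_rising 0 n l / INR (S n))).
  rewrite <- !rsum_plus; apply rsum_ext; intros n _.
  assert (INR (S n) <> 0) by (apply not_0_INR; lia).
  assert (INR (S (S n)) <> 0) by (apply not_0_INR; lia).
  pose proof (inv_rising_S 0 n l) as H1; rewrite Nat.add_0_l in H1.
  replace (shift (inv_rising 0 (S n)) l)
    with (INR (S n) * inv_rising 0 (S n) l - inv_rising 0 n l) by lra.
  cbn [rising].
  rewrite (S_INR (S n)) in *; field; auto.
Qed.

Lemma rsum_zero_lim (f : nat -> R) : (forall n, f n = 0) -> is_lim_seq (fun N => rsum N f) 0.
Proof.
  intros Hf; apply is_lim_seq_ext with (fun _ => 0); [|apply is_lim_seq_const].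
  intros; symmetry; apply rsum_zero; intros; apply Hf.
Qed.

(** The coefficient of x^l y^k in 1 + (x+y) K. At k = 0 the product y K contributes nothing, hence
    the separate cases. *)
Definition inner_value (k l : nat) : R :=
  match k, l with
  | O, O => 1
  | O, S _ => INR l * zeta (l + 1)
  | S _, _ => C (k + l + 1) (k + 1) * zeta (k + l + 1)
  end.

Lemma inner_lim k l :
  is_lim_seq
    (fun N => rsum N (fun n => rising (S n) k * inv_rising 0 (S n) l
                               / (INR (S n) * INR (S (S n)))))
    (inner_value k l).
Proof.
  set (kl := match l with O => 0 | S l' => C (k + l' + 1) (k + 1) * zeta (k + l' + 2) end).
  set (kk := match k with O => 0 | S k' => C (k' + l + 1) (k' + 1) * zeta (k' + l + 2) end).
  replace (inner_value k l) with (kl + kk + (rising 0 k * inv_rising 0 0 l - 0)).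
  - eapply is_lim_seq_ext; [intros N; symmetry; apply inner_sum|].
    apply is_lim_seq_plus'; [apply is_lim_seq_plus'|].
    + unfold kl; destruct l as [|l]; cbn [shift]; [|apply core_lim].
      apply rsum_zero_lim; intros n; unfold Rdiv; ring.
    + unfold kk; destruct k as [|k]; cbn [shift]; [|apply core_lim].
      apply rsum_zero_lim; intros n; unfold Rdiv; ring.
    + apply is_lim_seq_minus'; [apply is_lim_seq_const|apply weight_boundary_lim].
  - unfold kl, kk; destruct k as [|k], l as [|l]; cbn [rising inv_rising inner_value].
    + ring.
    + replace (0 + l + 1)%nat with (S l) by lia; rewrite C_1.
      replace (S l + 1)%nat with (0 + l + 2)%nat by lia; ring.
    + rewrite !Nat.add_0_r, !C_diag.
      replace (S k + 1)%nat with (k + 2)%nat by lia; ring.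
    + replace (S k + S l + 1)%nat with (S (S k + l + 1)) by lia.
      replace (S k + 1)%nat with (S (k + 1)) by lia.
      rewrite <- pascal by lia.
      replace (k + S l + 1)%nat with (S k + l + 1)%nat by lia.
      replace (k + S l + 2)%nat with (S k + l + 2)%nat by lia.
      replace (S (S k + l + 1)) with (S k + l + 2)%nat by lia; ring.
Qed.

(** The relation (1-y) R = 1 + x (1 + (x+y) K), read off at x^l y^k. Passing from k-1 to k adds the
    term j = 0 of [rhs]; at k = 0, l >= 2, the subtracted zeta(l) lowers the coefficient C(l,1) to
    l-1. *)
Lemma rhs_step k l :
  (match k with O => 0 | S k' => rhs k' l end)
  + (match l with
     | O => 0
     | S l' => inner_value k l'
     end)
  + rising 0 k * inv_rising 0 0 l = rhs k l.
Proof.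
  destruct l as [|[|l]].
  - destruct k; simpl; ring.
  - destruct k as [|k]; [simpl; ring|].
    cbn [rhs rising inv_rising inner_value]; rewrite rsum_first, Nat.add_0_r, C_diag, Nat.sub_0_r.
    cbn [Nat.add Nat.sub]; ring.
  - destruct k as [|k]; cbn [rhs rising inv_rising inner_value].
    + cbn [rsum]; rewrite Nat.add_0_l, !Nat.sub_0_r.
      rewrite C_1, (S_INR (S l)); replace (S l + 1)%nat with (S (S l)) by lia; ring.
    + rewrite (rsum_first (S k)), !Nat.sub_0_r.
      replace (S k + S l + 1)%nat with (S k + S (S l))%nat by lia.
      cbn [Nat.add Nat.sub]; ring.
Qed.

(** Induction on k inverts 1-y: in [outer_sum] the y-term is the same series at k-1, and the x-term
    is the inner series. *)
Lemma weighted_series_lim k l :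
  is_lim_seq (fun N => rsum N (fun n => rising n k * inv_rising 0 n l
                                        / (INR (S n) * INR (S (S n))))) (rhs k l).
Proof.
  induction k as [|k IH]; rewrite <- rhs_step;
    rewrite <- (Rminus_0_r (rising 0 _ * _));
    (eapply is_lim_seq_ext; [intros N; symmetry; apply outer_sum|]);
    (apply is_lim_seq_plus'; [apply is_lim_seq_plus'|
       apply is_lim_seq_minus'; [apply is_lim_seq_const|apply weight_boundary_lim]]).
  1: cbn [shift]; apply rsum_zero_lim; intros n; unfold Rdiv; ring.
  2: exact IH.
  all: destruct l as [|l]; cbn [shift]; [|apply inner_lim].
  all: apply rsum_zero_lim; intros n; unfold Rdiv; ring.
Qed.

Theorem theorem1 (k l : nat) :
  Un_cv (fun N => rsum N (fun n => summand k l n)) (rhs k l).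
Proof.
  apply is_lim_seq_Reals.
  eapply is_lim_seq_ext; [|apply weighted_series_lim].
  intros N; apply rsum_ext; intros n _; unfold summand.
  rewrite Qn_Pn_harmonic.
  replace (n + 1)%nat with (S n) by lia; replace (n + 2)%nat with (S (S n)) by lia.
  reflexivity.
Qed.
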